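(* Let $(a(n))_{n\ge 1}$ be the Binary Enots Wolley sequence. For every $n>2$, $a(n)$ is the smallest positive integer $m$ not yet in the sequence (i.e. $m\notin\{a(1),\dots,a(n-1)\}$) such that: (i) $\operatorname{supp}(m)\cap\operatorname{supp}(a(n-1))$ is nonempty, (ii) $\operatorname{supp}(m)\cap\operatorname{supp}(a(n-2))$ is empty, and (iii) the set $\operatorname{supp}(m)\setminus\operatorname{supp}(a(n-1))$ is nonempty.
   Context: For a positive integer $k$, $\operatorname{supp}(k)$ denotes the set of positions of the $1$s in the binary expansion of $k$ (positions are numbered from $0$, so $\operatorname{supp}(15)=\{0,1,2,3\}$ and $\operatorname{supp}(1)=\{0\}$). The Binary Enots Wolley sequence $(a(n))_{n\ge1}$ is the lexicographically earliest infinite sequence of distinct positive integers such that, whenever the terms referred to exist, the binary expansions of $a(n)$ and $a(n-1)$ have a $1$ in a common position ($\operatorname{supp}(a(n))\cap\operatorname{supp}(a(n-1))\ne\emptyset$ for $n\ge 2$), while the positions of the $1$s in the binary expansions of $a(n)$ and $a(n-2)$ are disjoint ($\operatorname{supp}(a(n))\cap\operatorname{supp}(a(n-2))=\emptyset$ for $n\ge 3$). The sequence begins $1,3,6,12,9,17,18,\dots$. *)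

(* Defs.v *)
From mathcomp Require Import all_boot.
From mathcomp Require Import boolp classical_sets.

Set Implicit Arguments.
Unset Strict Implicit.
Unset Printing Implicit Defensive.

Local Open Scope classical_set_scope.

Definition supp (k : nat) : set nat := [set i | odd (k %/ 2 ^ i)].

(* Sequences (a(n))_{n >= 1} are functions nat -> nat whose value at 0 is
   irrelevant: every condition below only constrains positive indices. *)
Definition bew_admissible (a : nat -> nat) : Prop :=
  [/\ forall n, 1 <= n -> 0 < a n,
      forall i j, 1 <= i -> 1 <= j -> a i = a j -> i = j,
      forall n, 2 <= n -> supp (a n) `&` supp (a (n - 1)) !=set0
    & forall n, 3 <= n -> supp (a n) `&` supp (a (n - 2)) = set0].

Definition lex_le (a b : nat -> nat) : Prop :=
  (forall n, 1 <= n -> a n = b n) \/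
  exists n, [/\ 1 <= n, forall i, 1 <= i < n -> a i = b i & a n < b n].

Definition binary_enots_wolley (a : nat -> nat) : Prop :=
  bew_admissible a /\ forall b, bew_admissible b -> lex_le a b.

Definition is_smallest (P : nat -> Prop) (k : nat) : Prop :=
  P k /\ forall m, P m -> k <= m.

(* Main.v *)
(** A term [a n] always has a bit outside [a (n - 1)], because [a (n + 1)] must
    meet [a n] but avoid [a (n - 1)].  Conversely, a finite prefix ending in [m]
    with a bit [p] of [m] outside the previous term never gets stuck: it can be
    continued with the supports [{p, K}], [{K, K+1}], [{K+1, K+2}], ..., where all
    bits from [K] on are fresh.  So a smaller candidate [m] at position [n] would
    give a lexicographically smaller admissible sequence. *)
Require Import Defs.
From mathcomp Require Import all_boot.
From mathcomp Require Import boolp classical_sets.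
From mathcomp Require Import zify.

Local Open Scope classical_set_scope.

Lemma supp_lt (x k : nat) : supp x k -> k < x.
Proof.
rewrite /supp /= => hk; have h2k : k < 2 ^ k by exact: ltn_expl.
apply: (leq_trans h2k); rewrite leqNgt; apply/negP => hx.
by rewrite divn_small in hk.
Qed.

(** For [k <= p] the quotient is [2 ^ (p - k)] plus an even power, hence odd only at [k = p]; for
    [p < k <= q] division discards the lower power; past [q] the sum is below [2 ^ k]. *)
Lemma supp_add_pow (p q k : nat) : p < q ->
  supp (2 ^ p + 2 ^ q) k <-> k = p \/ k = q.
Proof.
move=> pq; rewrite /supp /=.
have pos : 0 < 2 ^ k by rewrite expn_gt0.
have expB r : k <= r -> 2 ^ r = 2 ^ (r - k) * 2 ^ k.
  by move=> kr; rewrite -expnD subnK.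
case: (leqP k p) => kp.
  rewrite (expB p) // (expB q) ?(leq_trans kp (ltnW pq)) // -mulnDl mulnK //.
  by rewrite oddD !oddX !orbF; lia.
have small : 2 ^ p < 2 ^ k by rewrite ltn_exp2l.
case: (leqP k q) => kq.
  rewrite (expB q) // addnC divnMDl // (divn_small small) addn0 oddX orbF; lia.
rewrite divn_small; first lia.
have h1 : 2 ^ p < 2 ^ q by rewrite ltn_exp2l.
have h2 : 2 ^ q.+1 <= 2 ^ k by rewrite leq_exp2l.
by rewrite expnS in h2; lia.
Qed.

(** This turns a finite prefix into a competitor for lexicographic minimality. *)
Lemma admissible_extension (x : nat -> nat) (n p : nat) :
  (forall i, 1 <= i <= n -> 0 < x i) ->
  (forall i j, 1 <= i -> i < j <= n -> x i <> x j) ->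
  (forall i, 2 <= i <= n -> supp (x i) `&` supp (x (i - 1)) !=set0) ->
  (forall i, 3 <= i <= n -> supp (x i) `&` supp (x (i - 2)) = set0) ->
  supp (x n) p -> ~ supp (x (n - 1)) p ->
  exists2 b, bew_admissible b & forall i, i <= n -> b i = x i.
Proof.
move=> xpos xinj xmeet xdisj pn pn1.
(* The sum dominates every [x i] with [i <= n], and each such [x i] exceeds all its bit
   positions. *)
pose K := \sum_(j < n.+1) x j.
have fresh i k : i <= n -> supp (x i) k -> k < K.
  move=> le_in /supp_lt /leq_trans; apply.
  by rewrite /K (bigD1 (Ordinal (le_in : i < n.+1))) //= leq_addr.
have pK : p < K by exact: fresh pn.
(* The tail term [c t] has support [{e t, e t.+1}]: neighbours share one bit, and since [e]
   increases, terms two apart share none. *)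
pose e t := if t is s.+1 then K + s else p.
have ltE s t : s < t -> e s < e t.
  by case: s t => [|s] [|t] //= st; lia.
pose c t := 2 ^ e t + 2 ^ e t.+1.
have cE t k : supp (c t) k <-> k = e t \/ k = e t.+1.
  by apply: supp_add_pow; apply: ltE.
pose b i := if i <= n then x i else c (i - n.+1).
have bx i : i <= n -> b i = x i by rewrite /b => ->.
have bc t : b (n.+1 + t) = c t.
  by rewrite /b ifF ?addKn //; lia.
have split i : i <= n \/ exists t, i = n.+1 + t.
  by case: (leqP i n) => h; [left | right; exists (i - n.+1); lia].
exists b => //; split.
- move=> i i1; case: (split i) => [h|[t ->]]; first by rewrite bx ?xpos ?i1.
  by rewrite bc /c addn_gt0 expn_gt0.
- suff inj i j : 1 <= i -> i < j -> b i <> b j.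
    move=> i j i1 j1 bij; case: (ltngtP i j) => // h; first by case: (inj i j).
    by case: (inj j i).
  move=> i1 ij; case: (split j) => [jn|[t jE]].
    by rewrite !bx ?(leq_trans (ltnW ij)) //; apply: xinj; rewrite ?ij.
  rewrite {}jE bc in ij *; move=> bij.
  (* The top bit of [c t] separates it from all earlier terms: it is at least [K], and it exceeds
     both bits of [c s] for [s < t]. *)
  have top : supp (b i) (e t.+1) by rewrite bij; apply/cE; right.
  case: (split i) => [le_in|[s iE]].
    by rewrite bx // in top; move/(fresh _ _ le_in): top => /=; lia.
  rewrite {}iE bc in ij top *; have st : s < t by lia.
  have := ltE s t.+1 (ltnW st); have := ltE s.+1 t.+1 st.
  by case/cE: top => ->; rewrite ltnn.
- move=> i i2; case: (split i) => [le_in|[[|t] ->]].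
  + by rewrite !bx; [apply: xmeet; rewrite i2 | lia | lia].
  + exists p; rewrite bc bx; last lia.
    have -> : n.+1 + 0 - 1 = n by lia.
    by split=> //; apply/cE; left.
  + have -> : n.+1 + t.+1 - 1 = n.+1 + t by lia.
    by rewrite !bc; exists (e t.+1); split; apply/cE; [left | right].
- move=> i i3; case: (split i) => [le_in|[[|[|t]] ->]].
  + by rewrite !bx ?xdisj ?i3 //; lia.
  (* The first new term has bits [p], excluded from [x (n - 1)] by hypothesis, and [K], which is
     fresh. *)
  + have -> : n.+1 + 0 - 2 = n - 1 by lia.
    rewrite bc bx; last lia.
    rewrite -subset0 => k [/cE[->|->] //] h.
    by have /= := fresh _ _ (leq_subr 1 n) h; lia.
  + have -> : n.+1 + 1 - 2 = n by lia.
    rewrite bc bx // -subset0 => k [/cE h1 h2].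
    by have := fresh _ _ (leqnn n) h2; case: h1 => /= ->; lia.
  + have -> : n.+1 + t.+2 - 2 = n.+1 + t by lia.
    rewrite !bc -subset0 => k [/cE h1 /cE h2].
    have h3 : e t < e t.+1 by exact: ltE.
    have h4 : e t.+1 < e t.+2 by exact: ltE.
    have h5 : e t.+2 < e t.+3 by exact: ltE.
    by change False; case: h1 h2 => -> []; lia.
Qed.

Theorem theorem1 (a : nat -> nat) (ha : binary_enots_wolley a)
    (n : nat) (hn : 2 < n) :
  is_smallest
    (fun m : nat =>
       [/\ 0 < m,
           forall i : nat, 1 <= i < n -> m <> a i,
           supp m `&` supp (a (n - 1)) !=set0,
           supp m `&` supp (a (n - 2)) = set0
         & supp m `\` supp (a (n - 1)) !=set0])
    (a n).
Proof.
case: ha => -[apos ainj ameet adisj] amin; split.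
  split; [by apply: apos; lia | | by apply: ameet; lia | exact: adisj |].
    by move=> i hi /ainj hni; have := hni; lia.
  (* The bit of [a n] outside [a (n - 1)] is one shared with [a n.+1]. *)
  have [|k [k1 k0]] := ameet n.+1; first by lia.
  rewrite subn1 /= in k0; exists k; split=> // k2.
  have := adisj n.+1 (ltnW hn); rewrite -subset0 => /(_ k); apply.
  by split=> //; have -> : n.+1 - 2 = n - 1 by lia.
move=> m [mpos mnew mmeet mdisj [p [pm pa]]].
rewrite leqNgt; apply/negP => ltm.
(* Only the values of [x] up to [n] survive in the extension [b]. *)
pose x i := if i == n then m else a i.
have xn : x n = m by rewrite /x eqxx.
have xa i : i < n -> x i = a i by move=> lt_in; rewrite /x ltn_eqF.
have cases i : i <= n -> i = n \/ i < n by lia.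
have [||||||b bad bx] := @admissible_extension x n p.
- move=> i /andP[i1 /cases[->|lt_in]]; first by rewrite xn.
  by rewrite xa ?apos.
- move=> i j i1 /andP[ij /cases[jn|jn]].
    by subst j; rewrite xn xa // => /esym; apply: mnew; rewrite i1.
  by rewrite !xa ?(ltn_trans ij) // => /ainj; lia.
- move=> i /andP[i2 /cases[->|lt_in]]; first by rewrite xn xa //; lia.
  by rewrite !xa; [exact: ameet | lia | lia].
- move=> i /andP[i3 /cases[->|lt_in]]; first by rewrite xn xa //; lia.
  by rewrite !xa ?adisj //; lia.
- by rewrite xn.
- by rewrite xa //; lia.
have bn : b n = m by rewrite bx.
have ba i : i < n -> b i = a i by move=> lt_in; rewrite bx ?xa // ltnW.
case: (amin b bad) => [ab | [k [k1 abk ltk]]].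
  by have := ab n; rewrite bn; lia.
(* The first difference between [a] and [b] is at [n], where [b] is smaller, so no [k] fits. *)
case: (ltngtP k n) => [kn | nk | kn].
- by rewrite ba // ltnn in ltk.
- by have := abk n; rewrite bn; lia.
- by subst k; rewrite bn in ltk; lia.
Qed.
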